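(* Let $X$ be a path connected compact metrizable space and $Y$ a compact metrizable space. Let $p,q$ be fixed points of $X$, let $z,w$ be fixed points of $Y$, and let $\alpha,\beta\in(0,1)$ be rational numbers with $\beta>\alpha$. For any finite subset $F\subset C(X)_{(p,q,\alpha)}$, any $\epsilon>0$, and any unital positive linear map $\phi:C(X)\to C(Y)$ which sends $C(X)_{(p,q,\alpha)}$ to $C(Y)_{(z,w,\beta)}$, there are $N$ homomorphisms $\phi_1,\phi_2,\dots,\phi_N:C(X)\to C(Y)$ (for some positive integer $N$) such that $\frac1N\sum_{i=1}^N\phi_i(f)$ belongs to $C(Y)_{(z,w,\beta)}$ for all $f\in C(X)_{(p,q,\alpha)}$, and $$\Big\|\phi(f)-\frac1N\sum_{i=1}^N\phi_i(f)\Big\|<\epsilon\quad\text{for all } f\in F.$$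
   Context: For a compact metrizable space $X$, $C(X)$ is the C*-algebra of continuous functions on $X$ with the supremum norm. For points $p,q\in X$, $z,w\in Y$ and $\alpha,\beta\in(0,1)$, $$C(X)_{(p,q,\alpha)}=\{f\in C(X)\mid f(p)=\alpha f(q)\},\qquad C(Y)_{(z,w,\beta)}=\{f\in C(Y)\mid f(z)=\beta f(w)\}.$$ Homomorphism means $*$-homomorphism. A linear map is positive if it sends nonnegative functions to nonnegative functions, and unital if it sends the constant function $1$ to the constant function $1$. *)

(* Defs.v *)
From HB Require Import structures.
From mathcomp Require Import all_boot all_order all_algebra complex.
From mathcomp Require Import all_classical all_reals all_analysis.

Set Implicit Arguments.
Unset Strict Implicit.
Unset Printing Implicit Defensive.

Import Order.TTheory GRing.Theory Num.Theory.
Import numFieldNormedType.Exports.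

Local Open Scope classical_set_scope.
Local Open Scope ring_scope.
Local Open Scope complex_scope.

Definition metrizable (R : realType) (X : topologicalType) : Prop :=
  exists d : X -> X -> R,
    [/\ forall x y, d x y = 0 <-> x = y,
        forall x y, d x y = d y x,
        forall x y z, d x z <= d x y + d y z
      & forall x (A : set X),
          nbhs x A <-> exists2 e : R, 0 < e & [set y | d x y < e] `<=` A].

Definition path_connected (R : realType) (X : topologicalType) : Prop :=
  forall x y : X, exists g : R -> X,
    [/\ {within `[0, 1], continuous g}, g 0 = x & g 1 = y].

(* The codomain is R[i]^o because the topology of a numeric field is attached
   to its regular algebra; R[i] by itself carries none. *)
Definition cfun (R : realType) (X : topologicalType) : Type :=
  continuousType X R[i]^o.

Definition continuous_pred (R : realType) (X : topologicalType) :
    {pred X -> R[i]^o} :=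
  mem [set f : X -> R[i]^o | continuous f].

Section cfun_sub.
Context {R : realType} {X : topologicalType}.

Definition cfun_Sub (f : X -> R[i]^o) (fP : f \in @continuous_pred R X) :
    cfun R X :=
  mkcts (set_mem fP).

Lemma cfun_rect (K : cfun R X -> Type) :
  (forall f (Pf : f \in @continuous_pred R X), K (cfun_Sub Pf)) ->
  forall u : cfun R X, K u.
Proof.
move=> Ksub [f [[Pf]]].
have -> : Pf = set_mem (mem_set (A := [set g : X -> R[i]^o | continuous g]) Pf).
  exact: Prop_irrelevance.
exact: Ksub.
Qed.

Lemma cfun_valP f (Pf : f \in @continuous_pred R X) :
  cfun_Sub Pf = f :> (X -> R[i]^o).
Proof. by []. Qed.

HB.instance Definition _ := isSub.Build _ _ (cfun R X) cfun_rect cfun_valP.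
HB.instance Definition _ := [Choice of cfun R X by <:].

Lemma continuous_pred_subring : subring_closed (@continuous_pred R X).
Proof.
split=> [|f g /set_mem cf /set_mem cg|f g /set_mem cf /set_mem cg];
  apply/mem_set.
- by move=> x; apply: cvg_cst.
- by move=> x; apply: cvgB; [exact: cf|exact: cg].
- by move=> x; apply: cvgM; [exact: cf|exact: cg].
Qed.
HB.instance Definition _ :=
  GRing.isSubringClosed.Build _ (@continuous_pred R X) continuous_pred_subring.

Lemma continuous_pred_scale : GRing.scaler_closed (@continuous_pred R X).
Proof.
move=> a f /set_mem cf; apply/mem_set => x.
by apply: cvgZl_tmp; exact: cf.
Qed.
HB.instance Definition _ :=
  GRing.isScaleClosed.Build R[i] (X -> R[i]^o) (@continuous_pred R X)
    continuous_pred_scale.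

HB.instance Definition _ := GRing.SubChoice_isSubComPzRing.Build _ _ (cfun R X) (subringClosedP _).
HB.instance Definition _ := [SubZmodule_isSubLmodule of cfun R X by <:].

Lemma conjc_continuous (f : cfun R X) :
  continuous (fun x => conjc (f x) : R[i]^o).
Proof.
move=> x; apply/cvgrPdist_lt => e e0.
have fx : (f : X -> R[i]^o) @ x --> f x by exact: cts_fun.
have /cvgrPdist_lt/(_ e e0) := fx.
apply: filterS => t.
have -> : conjc (f x) - conjc (f t) = conjc (f x - f t) by rewrite rmorphB.
by case: (f x - f t) => a b; rewrite !normc_def/= sqrrN.
Qed.

Definition cfun_star (f : cfun R X) : cfun R X := mkcts (@conjc_continuous f).

(* Meaningful as the C*-norm for compact X, where the range is bounded. *)
Definition sup_norm (f : cfun R X) : R := sup (range (fun x => complex.Re `|f x|)).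

Definition cfun_rel (p q : X) (a : R) : set (cfun R X) :=
  [set f | f p = a%:C * f q].

End cfun_sub.

Section cfun_maps.
Context {R : realType} {X Y : topologicalType}.
Implicit Type phi : {linear cfun R X -> cfun R Y}.

(* The order of R[i] is partial: 0 <= z means that z is real and nonnegative. *)
Definition positive_map phi : Prop :=
  forall f : cfun R X, (forall x, 0 <= f x) -> forall y, 0 <= phi f y.

Definition unital_map phi : Prop := phi 1 = 1.

(* A *-homomorphism is not required to be unital. *)
Definition star_hom phi : Prop :=
  {morph phi : f g / f * g} /\ {morph phi : f / cfun_star f}.

End cfun_maps.

(* Main.v *)
From HB Require Import structures.
Require Import Defs.
From mathcomp Require Import all_boot all_order all_algebra complex.
From mathcomp Require Import all_classical all_reals all_analysis.
From mathcomp Require Import ring lra.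

Import Order.TTheory GRing.Theory Num.Theory.
Import numFieldNormedType.Exports.

Local Open Scope classical_set_scope.
Local Open Scope ring_scope.

(** For each point y, the functional f |-> phi f y is a state of C(X), that is,
    a probability measure mu_y on X depending continuously on y.  A function f
    minus the constant (f p - alpha f q) / (1 - alpha) satisfies the relation at
    p and q, so the hypothesis on phi amounts to the identity of measures
    mu_z - beta mu_w = c (delta_p - alpha delta_q) with
    c = (1 - beta) / (1 - alpha) ([state_pair]).  An average of the evaluations
    f |-> f \o h_j satisfies the required relation as soon as its two empirical
    measures at z and w satisfy the same identity.

    The measures mu_y are first discretized.  A partition of unity h_i, with
    sample points x_i such that every function of F is nearly constant on the
    support of h_i, gives phi f close to the sum of the l_i f(x_i), where
    l_i = phi h_i are continuous weights on Y.  The partition can be chosen with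
    all the mass at p, and at q, on one index ([local_weights]); the identity
    then reads l_i(z) - beta l_i(w) = d_i with d_i rational, since alpha and
    beta are.  The solutions of such a system that are nonnegative with sum 1
    are approximated by rational solutions ([rat_approx_pair]), and the weights
    can be moved slightly, near z and near w, so as to take these rational
    values there ([weights_adjust]).

    It remains to realize continuous weights by maps.  A path through x_0, ...,
    x_n reduces this to finding N points on a line: the j-th one is a continuous
    version of the quantile at level j / N, which rests at i when
    N (l_0 + ... + l_(i-1)) <= j and j + 1 <= N (l_0 + ... + l_i).  Each of the
    n transitions is crossed by at most one of the N points at a time, whence an
    error of order 1 / N ([walk_average]), and no point is in transit where the
    N l_i are integers ([walk_average_exact]).  For N a large multiple of the
    denominators of the weights at z and w, the average is exact at these two
    points, and the identity above is inherited by the empirical measures.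

    All this is done for real functions ([real_average]).  A positive map sends
    real functions to real functions, so the complex statement follows by
    treating real and imaginary parts simultaneously. *)

(** * Sampling a weight vector along a line *)

Definition clamp01 {R : realType} (t : R) : R := Num.min 1 (Num.max 0 t).

Lemma clamp01_itv {R : realType} (t : R) : 0 <= clamp01 t <= 1.
Proof. by rewrite /clamp01 le_min ler01 le_max lexx ge_min lexx. Qed.

Lemma clamp01_le0 {R : realType} (t : R) : t <= 0 -> clamp01 t = 0.
Proof. by move=> t0; rewrite /clamp01 (max_idPl t0) min_r. Qed.

Lemma clamp01_ge1 {R : realType} (t : R) : 1 <= t -> clamp01 t = 1.
Proof. by move=> t1; rewrite /clamp01 max_r ?min_l //; lra. Qed.

Lemma clamp01_id {R : realType} (t : R) : 0 <= t <= 1 -> clamp01 t = t.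
Proof. by move=> /andP[t0 t1]; rewrite /clamp01 max_r // min_r. Qed.

Lemma clamp01_homo {R : realType} : {homo @clamp01 R : s t / s <= t}.
Proof.
move=> s t st; rewrite /clamp01 le_min ge_min lexx /= ge_min; apply/orP; right.
by rewrite ge_max le_max lexx le_max st orbT.
Qed.

(** The clamps cut the segment from x to N along the integer grid: the j-th term
    is the length of its intersection with the cell from j to j + 1. *)
Lemma sum_clamp01 {R : realType} (N : nat) (x : R) : 0 <= x <= N%:R ->
  \sum_(j < N) clamp01 (j.+1%:R - x) = N%:R - x.
Proof.
elim: N x => [|N IH] x /andP[x0 xN]; first by rewrite big_ord0; lra.
rewrite big_ord_recr /=; have [xN'|/ltW Nx] := leP x N%:R.
  rewrite IH ?x0// clamp01_ge1; first by rewrite -natr1; lra.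
  by rewrite -natr1; lra.
rewrite -natr1 in xN *.
rewrite big1 ?add0r; first by rewrite clamp01_id //; apply/andP; split; lra.
move=> j _; apply: clamp01_le0; rewrite subr_le0.
by apply: le_trans Nx; rewrite ler_nat.
Qed.

(** The open cells of the integer grid are disjoint.  The cell indicators are
    bounded by the increments of the step function j |-> [j < x], whose total
    variation is at most 1. *)
Lemma sum_open_cell_le1 {R : realType} (N : nat) (x : R) :
  \sum_(j < N) ((j%:R < x < j.+1%:R)%R%:R : R) <= 1.
Proof.
have H : \sum_(j < N) ((j%:R < x < j.+1%:R)%R%:R : R)
    <= (0 < x)%R%:R - (N%:R < x)%R%:R.
  elim: N => [|N IH]; first by rewrite big_ord0 subrr.
  rewrite big_ord_recr /=; apply: le_trans (lerD IH (lexx _)) _.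
  rewrite -addrA lerD2l -natr1.
  by case: (ltP N%:R x) => ?; case: (ltP x (N%:R + 1)) => ?;
    case: (ltP (N%:R + 1) x) => ? /=; lra.
by apply: le_trans H _; case: (ltP 0 x) => _; case: (ltP N%:R x) => _ /=; lra.
Qed.

(** A nonincreasing 0-1 sequence sums to its number k of ones, and then the
    right-hand side telescopes to G k.  Through this formula the nonlinear
    G \o sum becomes linear in the steps, so that it can be summed. *)
Lemma comp_sum_steps {R : realType} (n : nat) (G : R -> R) (c : nat -> R) :
  (forall i, (i < n)%N -> c i = 0 \/ c i = 1) ->
  (forall i k, (i <= k < n)%N -> c k <= c i) ->
  G (\sum_(i < n) c i)
  = G 0 + \sum_(i < n) (G i.+1%:R - G i%:R) * c i.
Proof.
elim: n => [|n IH] c01 cdec; first by rewrite !big_ord0 addr0.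
have [cn|cn] := c01 n (ltnSn n).
  rewrite !big_ord_recr /= cn mulr0 !addr0; apply: IH => [i ni|i k /andP[ik kn]].
    exact: c01 (ltnW ni).
  by apply: cdec; rewrite ik ltnS ltnW.
have c1 i : (i < n.+1)%N -> c i = 1.
  move=> ni; have [ci|//] := c01 i ni.
  by have := cdec i n; rewrite cn ci -ltnS ni ltnSn => /(_ isT); lra.
under eq_bigr => i _ do rewrite c1 //.
under [in RHS]eq_bigr => i _ do rewrite c1 // mulr1.
rewrite sumr_const card_ord -(big_mkord predT (fun i => G i.+1%:R - G i%:R)).
by rewrite telescope_sumr //; lra.
Qed.

Lemma comp_sum_steps_err {R : realType} (n : nat) (G : R -> R) (B : R)
    (c : nat -> R) :
  (forall t, `|G t| <= B) -> (forall i, 0 <= c i <= 1) ->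
  `|G (\sum_(i < n) c i)
    - (G 0 + \sum_(i < n) (G i.+1%:R - G i%:R) * c i)| <= 2 * B * n.+1%:R.
Proof.
move=> GB c01.
have B0 : 0 <= B by apply: le_trans (GB 0).
have H : `|\sum_(i < n) (G i.+1%:R - G i%:R) * c i| <= \sum_(i < n) (2 * B).
  apply: le_trans (ler_norm_sum _ _ _) _; apply: ler_sum => i _.
  have := GB i.+1%:R; have := GB i%:R; have := c01 i => /andP[c0 c1] h1 h2.
  rewrite normrM (ger0_norm c0).
  apply: le_trans (_ : 2 * B * 1 <= _); last by rewrite mulr1.
  apply: ler_pM => //; apply: le_trans (ler_normB _ _) _; lra.
move: H; rewrite sumr_const card_ord -[_ *+ n]mulr_natr.
have := GB 0; have := GB (\sum_(i < n) c i).
rewrite -natr1 !ler_norml; lra.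
Qed.

Lemma abel_increments {R : realType} (n : nat) (l G : nat -> R) :
  (\sum_(k < n.+1) l k) * G 0%N + \sum_(i < n) (G i.+1 - G i) *
     (\sum_(k < n.+1) l k - \sum_(k < i.+1) l k)
  = \sum_(i < n.+1) l i * G i.
Proof.
elim: n => [|n IH]; first by rewrite big_ord0 !big_ord1 addr0.
rewrite [RHS]big_ord_recr /= -IH.
rewrite [X in _ + X]big_ord_recr /= !(big_ord_recr n.+1) /=.
have -> : \sum_(i < n) (G i.+1 - G i) *
     (\sum_(k < n.+1) l k + l n.+1 - \sum_(k < i.+1) l k)
  = \sum_(i < n) (G i.+1 - G i) *
     (\sum_(k < n.+1) l k - \sum_(k < i.+1) l k) + l n.+1 * (G n - G 0%N).
  rewrite -(telescope_sumr G (leq0n n)) big_mkord mulr_sumr -big_split /=.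
  by apply: eq_bigr => i _; ring.
by ring.
Qed.

(** The position of the j-th of N points distributed along 0, ..., n according to
    the weights l: the point is past i when its cell from j to j + 1 lies beyond
    N (l 0 + ... + l i), and each step is a ramp instead of a jump so that the
    position depends continuously on l. *)
Definition walk {R : realType} (N n : nat) (l : nat -> R) (j : nat) : R :=
  \sum_(i < n) clamp01 (j.+1%:R - N%:R * \sum_(k < i.+1) l k).

Section walk_average.
Context {R : realType}.
Variables (N n : nat) (l : nat -> R) (G : R -> R) (B : R).
Hypotheses (N0 : (0 < N)%N) (l0 : forall i, 0 <= l i).
Hypotheses (l1 : \sum_(i < n.+1) l i = 1) (GB : forall t, `|G t| <= B).

Let L i := N%:R * \sum_(k < i.+1) l k.
Let c (j i : nat) := clamp01 (j.+1%:R - L i).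
Let lin j := G 0 + \sum_(i < n) (G i.+1%:R - G i%:R) * c j i.

Let L_homo i k : (i <= k)%N -> L i <= L k.
Proof.
move=> ik; rewrite /L ler_wpM2l// -!(big_mkord predT l).
by rewrite [leRHS](big_cat_nat (n := i.+1)) //= lerDl; apply: sumr_ge0.
Qed.

Let L_itv i : (i < n)%N -> 0 <= L i <= N%:R.
Proof.
move=> ni; rewrite mulr_ge0 ?sumr_ge0//=.
by rewrite (le_trans (L_homo _ _ (ltnW ni)))// /L l1 mulr1.
Qed.

Let sum_lin :
  \sum_(j < N) lin j = N%:R * \sum_(i < n.+1) l i * G i%:R.
Proof.
rewrite -(abel_increments n l (fun i => G i%:R)) l1 mul1r /lin big_split /=.
rewrite sumr_const card_ord exchange_big /= mulrDr mulr_natl; congr (_ + _).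
rewrite mulr_sumr; apply: eq_bigr => i _; rewrite -mulr_sumr sum_clamp01 ?L_itv//.
by rewrite /L; ring.
Qed.

Let c_homo j i k : (i <= k)%N -> c j k <= c j i.
Proof. by move=> ik; apply: clamp01_homo; rewrite lerD2l lerN2 L_homo. Qed.

Let c_step j i : ~~ (j%:R < L i < j.+1%:R) -> c j i = 0 \/ c j i = 1.
Proof.
rewrite negb_and -!leNgt => /orP[h|h]; [right|left].
  by apply: clamp01_ge1; rewrite -natr1; lra.
by apply: clamp01_le0; lra.
Qed.

Let lin_exact j : (forall i, (i < n)%N -> ~~ (j%:R < L i < j.+1%:R)) ->
  G (walk N n l j) = lin j.
Proof.
move=> good; apply: (comp_sum_steps n G (c j)) => [i ni|i k /andP[ik _]].
  exact/c_step/good.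
exact: c_homo.
Qed.

(** The linearized sum over j is exact; only the at most n points in transit are
    misplaced, and each of them costs at most 2 B n.+1. *)
Lemma walk_average :
  `|N%:R^-1 * \sum_(j < N) G (walk N n l j) - \sum_(i < n.+1) l i * G i%:R|
  <= 2 * B * n.+1%:R * n%:R / N%:R.
Proof.
have NR : 0 < N%:R :> R by rewrite ltr0n.
have B0 : 0 <= B by apply: le_trans (GB 0).
have -> : \sum_(i < n.+1) l i * G i%:R = N%:R^-1 * \sum_(j < N) lin j.
  by rewrite sum_lin mulKf// gt_eqF.
rewrite -mulrBr normrM [X in X * _]ger0_norm ?invr_ge0// mulrC.
rewrite ler_wpM2r ?invr_ge0// -sumrB.
apply: le_trans (ler_norm_sum _ _ _) _.
have bound (j : 'I_N) : `|G (walk N n l j) - lin j|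
    <= 2 * B * n.+1%:R * \sum_(i < n) (j%:R < L i < j.+1%:R)%R%:R.
  have C0 : 0 <= 2 * B * n.+1%:R by rewrite !mulr_ge0.
  have [[i bad]|good] := pselect (exists i : 'I_n, j%:R < L i < j.+1%:R);
    last first.
    rewrite lin_exact ?subrr ?normr0 ?mulr_ge0 ?sumr_ge0//.
    by move=> i ni; apply/negP => bad; apply: good; exists (Ordinal ni).
  apply: le_trans (comp_sum_steps_err n G B (c j) GB _) _.
    by move=> k; apply: clamp01_itv.
  rewrite ler_peMr// (bigD1 i)//= bad lerDl.
  by apply: sumr_ge0.
apply: le_trans (ler_sum _ (fun j _ => bound j)) _.
rewrite -mulr_sumr ler_wpM2l ?mulr_ge0// exchange_big /=.
apply: (@le_trans _ _ (\sum_(i < n) 1)); last by rewrite sumr_const card_ord.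
by apply: ler_sum => i _; apply: sum_open_cell_le1.
Qed.

(** An integer transition level lies in no open cell. *)
Lemma walk_average_exact : 
  (forall i, (i < n.+1)%N -> N%:R * l i \is a Num.nat) ->
  \sum_(j < N) G (walk N n l j) = N%:R * \sum_(i < n.+1) l i * G i%:R.
Proof.
move=> Nl; rewrite -sum_lin; apply: eq_bigr => j _.
apply: lin_exact => i ni.
have /natrP[m ->] : L i \is a Num.nat.
  rewrite /L mulr_sumr rpred_sum// => k _; apply: Nl.
  exact: ltn_trans (ltn_ord k) _.
by rewrite !ltr_nat ltnS; case: ltnP => //= h; rewrite -ltnNge.
Qed.

End walk_average.

(** * Rational approximation of weights *)

Lemma rat_approx_below {R : realType} (x delta : R) : 0 <= x -> 0 < delta ->
  exists r : rat, 0 <= r /\ x - delta <= ratr r <= x.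
Proof.
rewrite le_eqVlt => /predU1P[<-|x0] d0.
  by exists 0; split=> //; rewrite rmorph0; lra.
have [r] : exists r, ratr r \in `]Num.max 0 (x - delta), x[.
  by apply: rat_in_itvoo; rewrite gt_max x0; lra.
rewrite in_itv /= gt_max => /andP[/andP[r0 rd] rx]; exists r.
by rewrite (ltW rd) (ltW rx) -(@ler0q R) (ltW r0).
Qed.

(** All entries but the first are rounded down, and the first one takes up the
    difference: it can only grow, hence stays nonnegative, and it is rational
    because the total m is. *)
Lemma rat_approx_sum {R : realType} (n : nat) (nu : nat -> R) (m : rat)
    (delta : R) :
  (forall i, 0 <= nu i) -> \sum_(i < n.+1) nu i = ratr m -> 0 < delta ->
  exists u : nat -> rat, [/\ forall i, 0 <= u i, \sum_(i < n.+1) u i = m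
    & forall i, `|ratr (u i) - nu i| <= delta].
Proof.
move=> nu0 nus d0; pose e := delta / n.+1%:R.
have e0 : 0 < e by rewrite divr_gt0.
have [u uP] := choice (fun i => rat_approx_below _ _ (nu0 i) e0).
have ed : e <= delta by rewrite ler_pdivrMr ?ler_peMr ?ler1n// ltW.
have below i : ratr (u i) <= nu i by have [_ /andP[]] := uP i.
have above i : nu i - e <= ratr (u i) by have [_ /andP[]] := uP i.
pose u0 : rat := m - \sum_(i < n) u i.+1.
have u0E : ratr u0 - nu 0%N = \sum_(i < n) (nu i.+1 - ratr (u i.+1)).
  by rewrite /u0 rmorphB rmorph_sum /= -nus big_ord_recl sumrB /=; ring.
have u0_ge : 0 <= ratr u0 - nu 0%N.
  by rewrite u0E sumr_ge0// => i _; rewrite subr_ge0.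
have u0_le : ratr u0 - nu 0%N <= delta.
  rewrite u0E; apply: (@le_trans _ _ (\sum_(i < n) e)).
    by apply: ler_sum => i _; have := above i.+1; lra.
  rewrite sumr_const card_ord -mulr_natr /e mulrAC ler_pdivrMr//.
  by rewrite ler_wpM2l// ?ltW// ltr_nat.
exists (fun i => if i is k.+1 then u k.+1 else u0); split.
- case=> [|i]; last by have [] := uP i.+1.
  by rewrite -(@ler0q R); have := nu0 0%N; lra.
- by rewrite big_ord_recl /= subrK.
- case=> [|i]; first by rewrite ger0_norm.
  by have := above i.+1; have := below i.+1; rewrite ler_norml; lra.
Qed.

(** Let k = max 0 d be the positive part of d.  Then nu = lz - k is the minimum
    of lz and beta * lw: it is nonnegative, has a rational sum, and determines
    both vectors, as lz = nu + k and beta * lw = nu + (k - d).  So it is enough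
    to approximate nu.  The last clause serves when both vectors are weights at
    the same point, where a single value has to be prescribed; then
    (1 - beta) * lz = d shows that lz is already rational. *)
Lemma rat_approx_pair {R : realType} (n : nat) (lz lw : nat -> R) (beta : rat)
    (d : nat -> rat) (delta : R) :
  0 < beta < 1 -> 0 < delta ->
  (forall i, 0 <= lz i) -> (forall i, 0 <= lw i) ->
  \sum_(i < n.+1) lz i = 1 -> \sum_(i < n.+1) lw i = 1 ->
  (forall i, lz i - ratr beta * lw i = ratr (d i)) ->
  exists vz vw : nat -> rat,
    [/\ (forall i, 0 <= vz i) /\ (forall i, 0 <= vw i),
        \sum_(i < n.+1) vz i = 1 /\ \sum_(i < n.+1) vw i = 1,
        forall i, vz i - beta * vw i = d i,
        forall i, `|ratr (vz i) - lz i| <= delta /\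
                  `|ratr (vw i) - lw i| <= delta
      & (forall i, lz i = lw i) -> forall i, vz i = vw i].
Proof.
move=> /andP[b0 b1] d0 lz0 lw0 lz1 lw1 lzw.
have B0 : 0 < ratr beta :> R by rewrite ltr0q.
have B1 : ratr beta < 1 :> R by rewrite -(rmorph1 (@ratr R)) ltr_rat.
have bN0 : 1 - beta != 0 by rewrite lt0r_neq0// subr_gt0.
have BN0 : 1 - ratr beta != 0 :> R by rewrite lt0r_neq0// subr_gt0.
have [lE|lNE] := pselect (forall i, lz i = lw i).
  pose v i := d i / (1 - beta).
  have vE i : ratr (v i) = lz i.
    rewrite rmorphM /= fmorphV /= rmorphB /= rmorph1 -lzw -lE.
    by field; exact: BN0.
  have v0 i : 0 <= v i by rewrite -(@ler0q R) vE.
  have v1 : \sum_(i < n.+1) v i = 1.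
    apply: (@fmorph_inj _ _ (@ratr R)); rewrite rmorph_sum rmorph1 -lz1 /=.
    by apply: eq_bigr => i _; rewrite vE.
  exists v, v; split=> // i.
    by rewrite /v; field; exact: bN0.
  by rewrite -lE vE subrr normr0 ltW.
pose k i := Num.max 0 (d i).
have kE i : ratr (k i) = Num.max 0 (ratr (d i)) :> R.
  rewrite /k; case: (leP 0 (d i)) => h.
    by rewrite max_r// ler0q.
  by rewrite max_l ?rmorph0// ltW// ltrq0.
pose nu i := lz i - ratr (k i).
have nu0 i : 0 <= nu i.
  rewrite subr_ge0 kE ge_max lz0 /= -lzw gerBl.
  by rewrite mulr_ge0// ltW.
have nus : \sum_(i < n.+1) nu i = ratr (1 - \sum_(i < n.+1) k i).
  by rewrite sumrB lz1 rmorphB rmorph1 rmorph_sum.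
have e0 : 0 < ratr beta * delta by rewrite mulr_gt0.
(* The factor beta in the tolerance compensates the division by beta below. *)
have [u [u0 us uE]] := rat_approx_sum _ _ _ _ nu0 nus e0.
exists (fun i => u i + k i), (fun i => (u i + k i - d i) / beta).
have ds : \sum_(i < n.+1) d i = 1 - beta.
  apply: (@fmorph_inj _ _ (@ratr R)); rewrite rmorph_sum rmorphB rmorph1 /=.
  rewrite (eq_bigr (fun i : 'I_n.+1 => lz i - ratr beta * lw i)) => [|i _].
    by rewrite sumrB -mulr_sumr lz1 lw1 mulr1.
  by rewrite lzw.
split=> [|| i | i | /lNE //].
- split=> i; first by rewrite addr_ge0// /k le_max lexx.
  by rewrite divr_ge0 ?(ltW b0)// -addrA addr_ge0// subr_ge0 /k le_max lexx orbT.
- split; first by rewrite big_split /= us subrK.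
  rewrite -mulr_suml big_split big_split /= us sumrN ds; field; exact: lt0r_neq0.
- by field; exact: lt0r_neq0.
have := uE i; rewrite !rmorphM !rmorphB !rmorphD /= fmorphV /= -lzw => h.
have -> : (ratr (u i) + ratr (k i) - (lz i - ratr beta * lw i)) / ratr beta
    - lw i = (ratr (u i) - nu i) / ratr beta.
  by rewrite /nu; field; exact: lt0r_neq0.
have -> : ratr (u i) + ratr (k i) - lz i = ratr (u i) - nu i.
  by rewrite /nu; ring.
split; first by apply: le_trans h _; rewrite ler_piMl// ltW.
by rewrite normrM normfV (ger0_norm (ltW B0)) ler_pdivrMr// mulrC.
Qed.

(** * Continuous weights and paths *)

Lemma continuous_sum {R : realType} {T : topologicalType} (n : nat)
    (f : nat -> T -> R) : (forall i, continuous (f i)) ->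
  continuous (fun t => \sum_(i < n) f i t).
Proof.
move=> cf; apply: (@continuous_big R _ +%R 0 xpredT) => // -[a b].
by apply: cvgD; [exact: cvg_fst|exact: cvg_snd].
Qed.

Lemma clamp01_continuous {R : realType} : continuous (@clamp01 R).
Proof.
move=> t; apply: (@continuous_min R R (fun=> 1) (fun s => Num.max 0 s)).
  exact: cvg_cst.
by apply: (@continuous_max R R (fun=> 0) id); [exact: cvg_cst|exact: cvg_id].
Qed.

(** A tent of radius r around z, with r at most d z w when w differs from z, so
    that the tent vanishes at w. *)
Lemma metrizable_bump {R : realType} {X : topologicalType} (z w : X)
    (U : set X) : metrizable R X -> nbhs z U ->
  exists b : X -> R, [/\ continuous b, forall y, 0 <= b y <= 1, b z = 1,
    forall y, b y != 0 -> U y & w <> z -> b w = 0].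
Proof.
move=> [d [d0 dC dT dN]] /dN[e e0 eU].
have dge0 x y : 0 <= d x y.
  by have := dT x y x; rewrite (proj2 (d0 x x) erefl) (dC y x); lra.
have [r [r0 re rw]] : exists r, [/\ 0 < r, r <= e & w <> z -> r <= d z w].
  have [->|wz] := pselect (w = z); first by exists e; split.
  have dzw : 0 < d z w by rewrite lt0r dge0 andbT; apply/eqP => /d0 /esym.
  by exists (Num.min e (d z w)); rewrite lt_min e0 dzw !ge_min !lexx orbT.
have cd : continuous (d z).
  move=> y; apply/cvgrPdist_lt => t t0; apply/dN; exists t => // y' /= yy'.
  have := dT z y y'; have := dT z y' y; rewrite (dC y' y) ltr_norml; lra.
exists (fun y => Num.max 0 (1 - d z y / r)); split.
- move=> y; apply: (@continuous_max R X (fun=> 0)); first exact: cvg_cst.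
  apply: cvgB; first exact: cvg_cst.
  by apply: cvgM; [exact: cd|exact: cvg_cst].
- move=> y; rewrite le_max lexx ge_max ler01 /= lerBlDr lerDl.
  by rewrite divr_ge0// ltW.
- by rewrite (proj2 (d0 z z) erefl) mul0r subr0 max_r.
- move=> y by0; apply: eU => /=; apply: lt_le_trans re; rewrite ltNge.
  apply: contra by0 => ry; rewrite max_l// subr_le0.
  by rewrite ler_pdivlMr// mul1r.
- by move=> /rw h; rewrite max_l// subr_le0 ler_pdivlMr// mul1r.
Qed.

Section weights.
Context {R : realType} {X : topologicalType}.

(** Indices range over all of nat to avoid dependent types, but only those up to
    n count in the sum. *)
Definition weights (n : nat) (l : nat -> X -> R) : Prop :=
  [/\ forall i, continuous (l i), forall i x, 0 <= l i x
    & forall x, \sum_(i < n.+1) l i x = 1].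

(** Near z the weights are replaced by convex combinations with v, which keeps
    them nonnegative with sum 1. *)
Lemma weights_patch (n : nat) (l : nat -> X -> R) (z w : X) (U : set X)
    (v : nat -> R) : metrizable R X -> nbhs z U -> weights n l ->
  (forall i, 0 <= v i) -> \sum_(i < n.+1) v i = 1 ->
  exists l' : nat -> X -> R, [/\ weights n l', forall i, l' i z = v i,
      w <> z -> forall i, l' i w = l i w
    & forall y, (forall i, l' i y = l i y) \/ U y /\
        exists2 t, 0 <= t <= 1 & forall i, l' i y = (1 - t) * l i y + t * v i].
Proof.
move=> mX zU [cl l0 l1] v0 v1.
have [b [cb b01 bz bU bw]] := metrizable_bump z w U mX zU.
exists (fun i y => (1 - b y) * l i y + b y * v i); split.
- split=> [i x|i x|x].
  + apply: cvgD; last by apply: cvgM; [exact: cb|exact: cvg_cst].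
    by apply: cvgM; [apply: cvgB; [exact: cvg_cst|exact: cb]|exact: cl].
  + have /andP[b0 b1] := b01 x.
    by rewrite addr_ge0// mulr_ge0// subr_ge0.
  + by rewrite big_split /= -!mulr_sumr l1 v1; ring.
- by move=> i; rewrite bz; ring.
- by move=> /bw -> i; ring.
- move=> y; have [b0|b0] := eqVneq (b y) 0; [left => i|right].
    by rewrite b0; ring.
  by split; [exact: bU|exists (b y)].
Qed.

(** The patch is supported where l is within delta of its value at z, hence
    within 2 * delta of v. *)
Lemma weights_adjust (n : nat) (l : nat -> X -> R) (z w : X) (v : nat -> R)
    (delta : R) : metrizable R X -> weights n l ->
  (forall i, 0 <= v i) -> \sum_(i < n.+1) v i = 1 -> 0 < delta ->
  (forall i, `|v i - l i z| <= delta) ->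
  exists l' : nat -> X -> R, [/\ weights n l', forall i, l' i z = v i,
      w <> z -> forall i, l' i w = l i w
    & forall i y, (i < n.+1)%N -> `|l' i y - l i y| <= 2 * delta].
Proof.
move=> mX lW v0 v1 d0 vl; have [cl _ _] := lW.
have nU : \forall y \near z, forall i : 'I_n.+1, `|l i z - l i y| < delta.
  by apply: filter_forall => i; move/cvgrPdist_lt : (cl i z); exact.
have [l' [l'W l'z l'w l'y]] := weights_patch n l z w _ v mX nU lW v0 v1.
exists l'; split=> // i y ni; have [->|[Uy [t /andP[t0 t1] ->]]] := l'y y.
  by rewrite subrr normr0 mulr_ge0// ltW.
have -> : (1 - t) * l i y + t * v i - l i y = t * (v i - l i y) by ring.
rewrite normrM ger0_norm//; apply: le_trans (ler_piMl _ t1) _ => //.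
have := Uy (Ordinal ni); have := vl i => /=.
by rewrite !ler_norml ltr_norml; lra.
Qed.

(** A partition of unity subordinate to finitely many E x, patched at p and then
    at q so that the sample point carrying all the mass is p, respectively q,
    itself.  When p = q the second patch overrides the first, which is why a and
    b are not required to be distinct. *)
Lemma local_weights (E : X -> set X) (p q : X) :
  compact [set: X] -> metrizable R X -> (forall x, nbhs x (E x)) ->
  exists (n : nat) (x : nat -> X) (h : nat -> X -> R),
    [/\ weights n h, forall i y, h i y != 0 -> E (x i) y,
      exists2 a, (a < n.+1)%N & x a = p /\ forall i, h i p = (i == a)%:R
    & exists2 b, (b < n.+1)%N & x b = q /\ forall i, h i q = (i == b)%:R].
Proof.
move=> cX mX nE.
have [b bP] := choice (fun x => metrizable_bump x x (E x) mX (nE x)).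
have [s scov] : exists s : seq X, forall y, exists2 c, c \in s & 0 < b c y.
  suff [s _ scov] : finite_subset_cover setT (fun c => [set y | 0 < b c y])
      [set: X].
    by exists (finmap.enum_fset s) => y; have [c] := scov y I; exists c.
  (* The covering form of compactness is stated for pointed spaces. *)
  pose pX : ptopologicalType := HB.pack X (isPointed.Build X p).
  have : @compact pX [set: X] by [].
  rewrite compact_cover; apply => [c _|y _].
    apply: (@open_comp _ _ (b c) [set t | 0 < t]); last exact: open_gt.
    by move=> y _; have [+ _ _ _ _] := bP c; exact.
  by exists y => //=; have [_ _ -> _ _] := bP y.
(* The indices 0 and 1 are reserved for p and q, with no mass before patching. *)
pose x i := nth p [:: p, q & s] i.
pose g i := if i is k.+2 then (if (k < size s)%N then b (nth p s k) else fun=> 0)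
            else fun=> 0.
pose n := (size s).+1.
pose S y := \sum_(i < n.+1) g i y.
have cg i : continuous (g i).
  case: i => [|[|i]] /=; try by move=> ?; exact: cvg_cst.
  by case: ifP => _; [have [] := bP (nth p s i)|move=> ?; exact: cvg_cst].
have g0 i y : 0 <= g i y.
  case: i => [|[|i]] //=; case: ifP => _ //.
  by have [_ /(_ y)/andP[]] := bP (nth p s i).
have S0 y : 0 < S y.
  have [c cs bc] := scov y.
  have ics : (index c s < size s)%N by rewrite index_mem.
  have i2 : ((index c s).+2 < n.+1)%N by rewrite /n !ltnS.
  rewrite /S (bigD1 (Ordinal i2)) //= ics nth_index//.
  by rewrite ltr_pwDl// sumr_ge0.
pose h0 i y := g i y / S y.
have h0W : weights n h0.
  split=> [i y|i y|y].
  - apply: cvgM; first exact: cg.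
    apply: cvgV; first by rewrite gt_eqF// S0.
    exact: continuous_sum.
  - by rewrite divr_ge0// ltW// S0.
  - by rewrite -mulr_suml divff// gt_eqF//; exact: S0.
have h0E i y : h0 i y != 0 -> E (x i) y.
  rewrite /h0 /x; case: i => [|[|i]] /=; rewrite ?mul0r ?eqxx//.
  case: ifP => [_|]; last by rewrite mul0r eqxx.
  have [_ _ _ bE _] := bP (nth p s i).
  by rewrite mulf_eq0 negb_or => /andP[/bE].
pose e (a i : nat) : R := (i == a)%:R.
have e0 a i : 0 <= e a i by [].
have e1 a : (a < n.+1)%N -> \sum_(i < n.+1) e a i = 1.
  move=> an; rewrite (bigD1 (Ordinal an))//= /e eqxx big1 ?addr0// => i.
  by rewrite -val_eqE /= => /negbTE ->.
have [h1 [h1W h1p _ h1y]] :=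
  weights_patch n h0 p p (E p) (e 0%N) mX (nE p) h0W (e0 _) (e1 _ (ltn0Sn _)).
have [h2 [h2W h2q h2p h2y]] :=
  weights_patch n h1 q p (E q) (e 1%N) mX (nE q) h1W (e0 _) (e1 1%N isT).
have h1E i y : h1 i y != 0 -> E (x i) y.
  have [->|[Ep [t _ ->]]] := h1y y; first exact: h0E.
  rewrite /e; case: (i =P 0%N) => [->//|_]; rewrite mulr0 addr0 mulf_eq0 negb_or.
  by move=> /andP[_ /h0E].
exists n, x, h2; split=> // [i y||].
- have [->|[Eq [t _ ->]]] := h2y y; first exact: h1E.
  rewrite /e; case: (i =P 1%N) => [->//|_]; rewrite mulr0 addr0 mulf_eq0 negb_or.
  by move=> /andP[_ /h1E].
- have [pq|pq] := pselect (p = q).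
    by exists 1%N => //; split=> // i; rewrite pq h2q.
  by exists 0%N => //; split=> // i; rewrite h2p.
- by exists 1%N.
Qed.

End weights.

(** The path from x n to x n.+1 is run on the interval from n to n + 1; clamping
    the time extends it to the line. *)
Lemma path_through {R : realType} {X : topologicalType} (x : nat -> X)
    (n : nat) : path_connected R X ->
  exists2 g : R -> X, continuous g & forall i, (i <= n)%N -> g i%:R = x i.
Proof.
move=> pX; elim: n => [|n [g cg gx]].
  exists (fun=> x 0%N); first by move=> ?; exact: cvg_cst.
  by move=> i; rewrite leqn0 => /eqP ->.
have [k [ck k0 k1]] := pX (x n) (x n.+1).
pose k' (t : R) := k (clamp01 (t - n%:R)).
have ck' : continuous k'.
  move=> t U /= kU.
  have A01 : [set` `[0, 1]] (clamp01 (t - n%:R)).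
    by rewrite /= in_itv /= clamp01_itv.
  have /(_ _ kU) := proj1 (subspace_continuousP _ _) ck _ A01.
  rewrite /= /within /= => near_k.
  have c : (fun s : R => clamp01 (s - n%:R)) @ t --> clamp01 (t - n%:R).
    apply: (@continuous_comp _ _ _ (fun s : R => s - n%:R) clamp01).
      by apply: cvgB; [exact: cvg_id|exact: cvg_cst].
    exact: clamp01_continuous.
  have near_t : \forall s \near t,
      clamp01 (s - n%:R) \in `[0, 1] -> U (k' s) := c _ near_k.
  apply: (@filterS R (nbhs t) _ _ _ _ near_t) => s; apply.
  by rewrite in_itv /= clamp01_itv.
pose G (t : R) := if t <= n%:R then g t else k' t.
have Ggk (t : R) : n%:R <= t -> G t = k' t.
  move=> nt; rewrite /G; case: (lerP t n%:R) => // tn.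
  have -> : t = n%:R by lra.
  by rewrite gx// /k' subrr clamp01_le0.
exists G.
  apply/continuous_subspace_setT.
  have -> : [set: R] = [set t | t <= n%:R] `|` [set t | n%:R <= t].
    by apply/esym; rewrite -subTset => t _ /=; case: (leP t n%:R) => [|/ltW];
      [left|right].
  apply: withinU_continuous; [exact: closed_le|exact: closed_ge| |].
    apply: (@subspace_eq_continuous _ _ _ g); last exact: continuous_subspaceT.
    by move=> t /set_mem /= tn; rewrite /from_subspace /G tn.
  apply: (@subspace_eq_continuous _ _ _ k'); last exact: continuous_subspaceT.
  by move=> t /set_mem /= tn; rewrite /from_subspace Ggk.
move=> i; rewrite leq_eqVlt => /predU1P[->|]; last first.
  by rewrite ltnS => ni; rewrite /G ler_nat ni gx.
rewrite Ggk ?ler_nat// /k' clamp01_ge1 ?k1// -natr1; lra.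
Qed.

(** * States and the approximation of real functions *)

Section states.
Context {R : realType} {X : topologicalType}.
Implicit Types (L : (X -> R) -> R) (f : X -> R).

(** A state of the algebra of continuous real functions; its values on other
    functions are arbitrary. *)
Definition state L : Prop :=
  [/\ forall (a : R) (f g : X -> R), continuous f -> continuous g ->
        L (fun x => a * f x + g x) = a * L f + L g,
      forall f, continuous f -> (forall x, 0 <= f x) -> 0 <= L f
    & L (fun=> 1) = 1].

Let ccst (a : R) : continuous (fun _ : X => a).
Proof. by move=> x; exact: cvg_cst. Qed.

Lemma continuousZD (a : R) f g : continuous f -> continuous g ->
  continuous (fun x => a * f x + g x).
Proof.
move=> cf cg x; apply: cvgD; last exact: cg.
by apply: cvgM; [exact: cvg_cst|exact: cf].
Qed.

Lemma state0 L : state L -> L (fun=> 0) = 0.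
Proof.
move=> [Llin _ _].
have := Llin (-1) (fun=> 0) (fun=> 0) (ccst 0) (ccst 0).
by under eq_fun do rewrite mulr0 addr0; lra.
Qed.

Lemma state_scale L (a : R) f : state L -> continuous f ->
  L (fun x => a * f x) = a * L f.
Proof.
move=> sL cf; have L0 := state0 L sL; case: sL => Llin _ _.
have := Llin a f (fun=> 0) cf (ccst _).
by rewrite L0 addr0; under eq_fun do rewrite addr0.
Qed.

Lemma state_sum L n (a : nat -> R) (h : nat -> X -> R) : state L ->
  (forall i, continuous (h i)) ->
  L (fun x => \sum_(i < n) a i * h i x) = \sum_(i < n) a i * L (h i).
Proof.
move=> sL ch; elim: n => [|n IH].
  by rewrite big_ord0 -[RHS](state0 L sL); congr L; apply/funext => x;
    rewrite big_ord0.
rewrite big_ord_recr /= -IH addrC; case: sL => Llin _ _; rewrite -Llin//.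
  by congr L; apply/funext => x; rewrite big_ord_recr /= addrC.
apply: (@continuous_sum R X n (fun i x => a i * h i x)) => i x.
by apply: cvgM; [exact: cvg_cst|exact: ch].
Qed.

(** The functions e + f and e - f are nonnegative. *)
Lemma state_bound L f (e : R) : state L -> continuous f ->
  (forall x, `|f x| <= e) -> `|L f| <= e.
Proof.
move=> sL cf fe; have [Llin Lpos L1] := sL.
have c1 := ccst e.
have Le : L (fun=> e) = e.
  have := state_scale L e (fun=> 1) sL (ccst _).
  by rewrite L1 mulr1.
have := Lpos _ (continuousZD 1 _ _ cf c1).
have := Lpos _ (continuousZD (-1) _ _ cf c1).
rewrite !Llin// Le ler_norml => h1 h2.
have {}h1 : 0 <= -1 * L f + e.
  by apply: h1 => x; have := fe x; rewrite ler_norml; lra.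
have {}h2 : 0 <= 1 * L f + e.
  by apply: h2 => x; have := fe x; rewrite ler_norml; lra.
lra.
Qed.

Lemma state_weights L n (h : nat -> X -> R) : state L -> weights n h ->
  (forall i, 0 <= L (h i)) /\ \sum_(i < n.+1) L (h i) = 1.
Proof.
move=> sL [ch h0 h1]; have [_ Lpos L1] := sL; split=> [i|]; first exact: Lpos.
rewrite -L1 (eq_bigr (fun i : 'I_n.+1 => 1 * L (h i))) => [|i _];
  last by rewrite mul1r.
rewrite -(state_sum L n.+1 (fun=> 1) h sL ch); congr L; apply/funext => x.
by under eq_bigr do rewrite mul1r; rewrite h1.
Qed.

Lemma weights_approx n (h : nat -> X -> R) (a : nat -> R) y (b e : R) :
  weights n h -> (forall i, h i y != 0 -> `|b - a i| <= e) ->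
  `|b - \sum_(i < n.+1) a i * h i y| <= e.
Proof.
move=> [_ h0 h1] ab.
have -> : b - \sum_(i < n.+1) a i * h i y = \sum_(i < n.+1) h i y * (b - a i).
  rewrite -[b in LHS]mulr1 -(h1 y) mulr_sumr -sumrB.
  by apply: eq_bigr => i _; ring.
apply: le_trans (ler_norm_sum _ _ _) _.
rewrite -[leRHS]mul1r -(h1 y) mulr_suml; apply: ler_sum => i _.
rewrite normrM ger0_norm//; have [->|hy] := eqVneq (h i y) 0;
  first by rewrite !mul0r.
by rewrite ler_wpM2l// ab.
Qed.

Lemma state_approx L n (h : nat -> X -> R) (a : nat -> R) f (e : R) :
  state L -> continuous f -> weights n h ->
  (forall i y, h i y != 0 -> `|f y - a i| <= e) ->
  `|L f - \sum_(i < n.+1) a i * L (h i)| <= e.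
Proof.
move=> sL cf hW fa; have [ch _ _] := hW; have [Llin _ _] := sL.
have cs : continuous (fun x => \sum_(i < n.+1) a i * h i x).
  apply: (@continuous_sum R X n.+1 (fun i x => a i * h i x)) => i x.
by apply: cvgM; [exact: cvg_cst|exact: ch].
rewrite -(state_sum L n.+1 a h sL ch) addrC -mulN1r -Llin//.
apply: state_bound => // [|x]; first exact: continuousZD.
rewrite mulN1r addrC; apply: weights_approx => // i; exact: fa.
Qed.

(** Subtracting the constant k = (f p - a * f q) / (1 - a) puts f in the subspace
    where the two states are proportional, and states agree on constants. *)
Lemma state_pair Lz Lw (p q : X) (a b : R) f : state Lz -> state Lw ->
  a < 1 ->
  (forall f, continuous f -> f p = a * f q -> Lz f = b * Lw f) ->
  continuous f ->
  Lz f - b * Lw f = (1 - b) / (1 - a) * (f p - a * f q).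
Proof.
move=> [zlin _ z1] [wlin _ w1] a1 rel cf.
have a0 : 1 - a != 0 by rewrite gt_eqF// subr_gt0.
pose k := (f p - a * f q) / (1 - a).
have c1 := ccst 1.
have := rel _ (continuousZD (- k) (fun=> 1) f c1 cf).
rewrite zlin// wlin// z1 w1 => h.
have {h} : - k * 1 + Lz f = b * (- k * 1 + Lw f).
  by apply: h; rewrite /k; field.
have -> : (1 - b) / (1 - a) * (f p - a * f q) = k - b * k by rewrite /k; field.
lra.
Qed.

End states.

Lemma common_denominator (n : nat) (v : nat -> rat) : (forall i, 0 <= v i) ->
  exists2 D : nat, (0 < D)%N &
    forall i, (i < n)%N -> D%:R * v i \is a Num.nat.
Proof.
move=> v0; elim: n => [|n [D D0 DP]]; first by exists 1%N.
exists (D * `|denq (v n)|)%N; first by rewrite muln_gt0 D0 absz_gt0 denq_neq0.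
move=> i; rewrite natrM ltnS leq_eqVlt => /predU1P[->|ni].
  rewrite -mulrA rpredM ?rpred_nat// pmulrn gez0_abs ?denq_ge0// mulrC -numqE.
  have : 0 <= numq (v n) by rewrite numq_ge0.
  by case: (numq (v n)) => // m _; rewrite /= rpred_nat.
by rewrite mulrAC rpredM// ?DP// rpred_nat.
Qed.

(** The approximation is assembled from three errors of eps / 3: replacing psi f
    by weighted samples, adjusting the weights at z and w, and replacing the
    weights by N maps. *)
Theorem real_average (R : realType) (X Y : topologicalType)
    (X_compact : compact [set: X]) (X_metrizable : metrizable R X)
    (X_path_connected : path_connected R X) (Y_metrizable : metrizable R Y)
    (p q : X) (z w : Y) (alpha beta : rat)
    (alpha1 : alpha < 1) (beta01 : 0 < beta < 1)
    (I : finType) (F : I -> X -> R) (F_cont : forall k, continuous (F k))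
    (eps : R) (eps_gt0 : 0 < eps)
    (psi : (X -> R) -> Y -> R)
    (psi_cont : forall f : X -> R, continuous f -> continuous (psi f))
    (psi_state : forall y, state (psi ^~ y))
    (psi_rel : forall f : X -> R, continuous f -> f p = ratr alpha * f q ->
       psi f z = ratr beta * psi f w) :
  exists (N : nat) (h : nat -> Y -> X),
    [/\ (0 < N)%N, forall j, continuous (h j),
      forall g : X -> R, g p = ratr alpha * g q ->
        \sum_(j < N) g (h j z) = ratr beta * \sum_(j < N) g (h j w)
    & forall k y, `|psi (F k) y - N%:R^-1 * \sum_(j < N) F k (h j y)| <= eps].
Proof.
have A1 : ratr alpha < 1 :> R by rewrite -(rmorph1 (@ratr R)) ltr_rat.
pose e1 := eps / 3.
have e10 : 0 < e1 by rewrite divr_gt0.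
have nE x : \forall y \near x, forall k, `|F k x - F k y| < e1.
  by apply: filter_forall => k; move/cvgrPdist_lt : (F_cont k x); exact.
have [n [x [h [hW hE [a an [xa ha]] [b bn [xb hb]]]]]] :=
  local_weights _ p q X_compact X_metrizable nE.
have hF k i y : h i y != 0 -> `|F k y - F k (x i)| <= e1.
  by move=> /hE /(_ k); rewrite distrC => /ltW.
have [ch h0 h1] := hW.
pose l i y := psi (h i) y.
have lW : weights n l.
  split=> [i|i y|y]; first exact: psi_cont.
    by have [+ _] := state_weights _ n h (psi_state y) hW; exact.
  by have [_ +] := state_weights _ n h (psi_state y) hW; exact.
have [_ l0 l1] := lW.
pose d i : rat := (1 - beta) / (1 - alpha) * ((i == a)%:R - alpha * (i == b)%:R).
have lzw i : l i z - ratr beta * l i w = ratr (d i).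
  rewrite (state_pair _ _ p q _ _ _ (psi_state z) (psi_state w) A1 psi_rel)//.
  by rewrite ha hb /d !(rmorphM, rmorphB, rmorph1, fmorphV, rmorph_nat).
pose B := e1 + \sum_k \sum_(i < n.+1) `|F k (x i)|.
have FB k y : `|F k y| <= B.
  have := weights_approx n h (fun i => F k (x i)) y _ _ hW (fun i => hF k i y).
  have : `|\sum_(i < n.+1) F k (x i) * h i y| <= \sum_k \sum_(i < n.+1) `|F k (x i)|.
    rewrite (bigD1 k)//=; apply: ler_wpDr.
      by rewrite !sumr_ge0// => *; rewrite sumr_ge0.
    apply: le_trans (ler_norm_sum _ _ _) _; apply: ler_sum => i _.
    rewrite normrM (ger0_norm (h0 _ _)) ler_piMr//.
    by rewrite -(h1 y) (bigD1 i)//= lerDl sumr_ge0.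
  by rewrite /B !ler_norml; lra.
have B0 : 0 < B by rewrite ltr_pwDl// sumr_ge0// => k _; rewrite sumr_ge0.
pose delta := eps / (12 * n.+1%:R * B).
have d0 : 0 < delta by rewrite divr_gt0// !mulr_gt0.
have [vz [vw [[vz0 vw0] [vz1 vw1] vzw vl vE]]] :=
  rat_approx_pair n (l ^~ z) (l ^~ w) beta d delta beta01 d0 (l0 ^~ z) (l0 ^~ w)
    (l1 z) (l1 w) lzw.
have ratr1 (v : nat -> rat) : \sum_(i < n.+1) v i = 1 ->
    \sum_(i < n.+1) (ratr (v i) : R) = 1.
  by move=> v1; rewrite -(rmorph1 (@ratr R)) -v1 rmorph_sum.
have ratr_ge0' (v : nat -> rat) : (forall i, 0 <= v i) ->
  forall i, 0 <= ratr (v i) :> R by move=> v0 i; rewrite ler0q.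
have [l' [l'W l'z l'w l'l]] := weights_adjust n l z w (fun i => ratr (vz i)) delta
  Y_metrizable lW (ratr_ge0' _ vz0) (ratr1 _ vz1) d0 (fun i => proj1 (vl i)).
have vl' i : `|ratr (vw i) - l' i w| <= delta.
  have [wz|wz] := pselect (w = z); last by rewrite l'w//; exact: (proj2 (vl i)).
  by rewrite wz l'z -vE ?wz// subrr normr0 ltW.
have [m [mW mw mz ml']] := weights_adjust n l' w z (fun i => ratr (vw i)) delta
  Y_metrizable l'W (ratr_ge0' _ vw0) (ratr1 _ vw1) d0 vl'.
(* If z = w the second adjustment overrides the first with the same value. *)
have {}mz i : m i z = ratr (vz i).
  have [zw|zw] := pselect (z = w); last by rewrite mz// l'z.
  by rewrite zw mw -vE// zw.
have [cm m0 m1] := mW.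
have ml i y : (i < n.+1)%N -> `|l i y - m i y| <= 4 * delta.
  by move=> ni; have := l'l i y ni; have := ml' i y ni; rewrite !ler_norml; lra.
have [Dz Dz0 DzP] := common_denominator n.+1 vz vz0.
have [Dw Dw0 DwP] := common_denominator n.+1 vw vw0.
(* The bound of [walk_average] is eps / 3 * c / N. *)
pose c := 6 * B * n.+1%:R * n%:R / eps.
pose K := (Num.truncn c).+1.
pose N := (K * (Dz * Dw))%N.
have N0 : (0 < N)%N by rewrite !muln_gt0 Dz0 Dw0.
have nat_vz i : (i < n.+1)%N -> N%:R * m i z \is a Num.nat.
  move=> /DzP/natrP[k kE]; rewrite mz /N (mulnC Dz) mulnA natrM -mulrA.
  rewrite rpredM ?rpred_nat// -(ratr_nat R Dz) -rmorphM /= kE ratr_nat.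
  exact: rpred_nat.
have nat_vw i : (i < n.+1)%N -> N%:R * m i w \is a Num.nat.
  move=> /DwP/natrP[k kE]; rewrite mw /N mulnA natrM -mulrA.
  rewrite rpredM ?rpred_nat// -(ratr_nat R Dw) -rmorphM /= kE ratr_nat.
  exact: rpred_nat.
have [g cg gx] := path_through x n X_path_connected.
have sum_gx (u : nat -> R) (G : X -> R) :
    \sum_(i < n.+1) u i * G (g i%:R) = \sum_(i < n.+1) u i * G (x i).
  by apply: eq_bigr => i _; rewrite gx// -ltnS.
exists N, (fun j y => g (walk N n (m ^~ y) j)); split=> //.
- move=> j y; apply: (@continuous_comp _ _ _ (fun y => walk N n (m ^~ y) j) g).
    move: y; apply: (@continuous_sum R Y n (fun i y =>
      clamp01 (j.+1%:R - N%:R * \sum_(k < i.+1) m k y))) => i y.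
    apply: (@continuous_comp _ _ _ (fun y =>
      j.+1%:R - N%:R * \sum_(k < i.+1) m k y) clamp01).
      apply: cvgB; first exact: cvg_cst.
      by apply: cvgM; [exact: cvg_cst|exact: continuous_sum].
    exact: clamp01_continuous.
  exact: cg.
- move=> G Gpq.
  have exact_at y : (forall i, (i < n.+1)%N -> N%:R * m i y \is a Num.nat) ->
      \sum_(j < N) G (g (walk N n (m ^~ y) j))
      = N%:R * \sum_(i < n.+1) m i y * G (x i).
    move=> Nm; rewrite -(sum_gx (m ^~ y)).
    by rewrite -(walk_average_exact N n (m ^~ y) (G \o g)).
  rewrite !exact_at//.
  rewrite mulrCA; congr (_ * _); rewrite mulr_sumr.
  apply/eqP; rewrite -subr_eq0 -sumrB; apply/eqP.
  have dE i : m i z * G (x i) - ratr beta * (m i w * G (x i))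
      = ratr ((1 - beta) / (1 - alpha)) *
        ((i == a)%:R * G (x i) - ratr alpha * ((i == b)%:R * G (x i))).
    rewrite mz mw mulrA -mulrBl -rmorphM -rmorphB /= vzw /d.
    by rewrite !(rmorphM, rmorphB, rmorph1, fmorphV, rmorph_nat) /=; ring.
  have delta_sum k : (k < n.+1)%N ->
      \sum_(i < n.+1) (i == k :> nat)%:R * G (x i) = G (x k).
    move=> kn; rewrite (bigD1 (Ordinal kn))//= eqxx mul1r big1 ?addr0// => i.
    by rewrite -val_eqE /= => /negbTE ->; rewrite mul0r.
  under eq_bigr do rewrite dE.
  rewrite -mulr_sumr sumrB -mulr_sumr.
  by rewrite !delta_sum// xa xb Gpq subrr mulr0.
- move=> k y.
  have S1 := state_approx _ n h (fun i => F k (x i)) _ _ (psi_state y)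
    (F_cont k) hW (hF k).
  have S2 : `|\sum_(i < n.+1) F k (x i) * l i y - \sum_(i < n.+1) m i y * F k (x i)|
      <= eps / 3.
    rewrite -sumrB; apply: le_trans (ler_norm_sum _ _ _) _.
    apply: (@le_trans _ _ (\sum_(i < n.+1) (4 * delta * B))).
      apply: ler_sum => i _.
      have -> : F k (x i) * l i y - m i y * F k (x i) = (l i y - m i y) * F k (x i).
        by ring.
      by rewrite normrM ler_pM// ml.
    rewrite sumr_const card_ord -[_ *+ _]mulr_natr /delta.
    rewrite le_eqVlt; apply/orP; left; apply/eqP; field.
    by rewrite gt_eqF //= gt_eqF.
  have S3 := walk_average N n (m ^~ y) (F k \o g) B N0 (m0 ^~ y) (m1 y)
    (fun t => FB k (g t)).
  have {}S3 : `|N%:R^-1 * \sum_(j < N) F k (g (walk N n (m ^~ y) j))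
      - \sum_(i < n.+1) m i y * F k (x i)| <= eps / 3.
    rewrite -(sum_gx (m ^~ y)); apply: le_trans S3 _.
    rewrite ler_pdivrMr ?ltr0n//.
    apply: (@le_trans _ _ (eps / 3 * c)).
      rewrite le_eqVlt; apply/orP; left; apply/eqP.
      by rewrite /c; field; rewrite gt_eqF.
    rewrite ler_wpM2l ?divr_ge0 ?ltW//.
    apply: (@lt_le_trans _ _ K%:R); first exact: truncnS_gt.
    by rewrite ler_nat leq_pmulr// muln_gt0 Dz0.
  move: S1 S2 S3; rewrite /e1 /l !ler_norml; lra.
Qed.

(** * From real to complex functions *)

Section real_parts.
Context {R : realType} {X : topologicalType}.
Local Open Scope complex_scope.

Lemma real_complex_continuous (f : X -> R) : continuous f ->
  continuous (fun x => (f x)%:C : R[i]^o).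
Proof.
move=> cf x; apply/cvgrPdist_lt => -[e e'].
rewrite ltcE /= => /andP[/eqP -> e0].
have /cvgrPdist_lt/(_ e e0) := cf x; apply: filterS => t.
by rewrite -rmorphB normc_def /= expr0n addr0 sqrtr_sqr ltcR.
Qed.

Definition real_cfun (f : X -> R) (cf : continuous f) : cfun R X :=
  mkcts (real_complex_continuous f cf).

Lemma Re_continuous (f : cfun R X) : continuous (fun x => complex.Re (f x)).
Proof.
move=> x; apply/cvgrPdist_lt => e e0.
have fx : (f : X -> R[i]^o) @ x --> f x by exact: cts_fun.
have e0' : 0 < e%:C by rewrite ltcR.
have /cvgrPdist_lt/(_ _ e0') := fx; apply: filterS => t.
case: (f x) (f t) => [a b] [a' b'] /=; rewrite normc_def ltcR /=.
apply: le_lt_trans; rewrite -sqrtr_sqr ler_sqrt ?addr_ge0 ?sqr_ge0//.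
by rewrite lerDl sqr_ge0.
Qed.

Lemma Im_continuous (f : cfun R X) : continuous (fun x => complex.Im (f x)).
Proof.
move=> x; apply/cvgrPdist_lt => e e0.
have fx : (f : X -> R[i]^o) @ x --> f x by exact: cts_fun.
have e0' : 0 < e%:C by rewrite ltcR.
have /cvgrPdist_lt/(_ _ e0') := fx; apply: filterS => t.
case: (f x) (f t) => [a b] [a' b'] /=; rewrite normc_def ltcR /=.
apply: le_lt_trans; rewrite -sqrtr_sqr ler_sqrt ?addr_ge0 ?sqr_ge0//.
by rewrite lerDr sqr_ge0.
Qed.

Lemma cfunP (f g : cfun R X) : (forall x, f x = g x) -> f = g.
Proof. by move=> fg; apply: val_inj; apply/funext => x; exact: fg. Qed.

Lemma cfun_sumE n (f : 'I_n -> cfun R X) x : (\sum_i f i) x = \sum_i f i x.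
Proof. by elim/big_rec2: _ => // i a b _ <-. Qed.

Lemma cfun_decomp (f : cfun R X) :
  f = real_cfun _ (Re_continuous f) + 'i *: real_cfun _ (Im_continuous f).
Proof. by apply: cfunP => x; rewrite {1}[f x]complexE. Qed.

Lemma Re_sum n (c : 'I_n -> R[i]) :
  complex.Re (\sum_i c i) = \sum_i complex.Re (c i).
Proof. exact: raddf_sum. Qed.

Lemma Im_sum n (c : 'I_n -> R[i]) :
  complex.Im (\sum_i c i) = \sum_i complex.Im (c i).
Proof. exact: raddf_sum. Qed.

Lemma norm_le_Re_Im (c : R[i]) (e : R) :
  `|complex.Re c| <= e -> `|complex.Im c| <= e -> complex.Re `|c| <= 2 * e.
Proof.
case: c => a b /= ae be; have e0 := le_trans (normr_ge0 a) ae.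
rewrite -(ger0_norm (mulr_ge0 (ler0n R 2) e0)) -sqrtr_sqr ler_wsqrtr//.
have a2 : a ^+ 2 <= e ^+ 2 by rewrite -(real_normK (num_real a)) lerXn2r ?nnegrE.
have b2 : b ^+ 2 <= e ^+ 2 by rewrite -(real_normK (num_real b)) lerXn2r ?nnegrE.
have := sqr_ge0 e; rewrite exprMn; lra.
Qed.

End real_parts.

Section precomposition.
Context {R : realType} {X Y : topologicalType}.
Variables (h : Y -> X) (ch : continuous h).

Lemma precomp_continuous (f : cfun R X) :
  continuous (fun y => f (h y) : R[i]^o).
Proof. by move=> y; apply: continuous_comp; [exact: ch|exact: cts_fun]. Qed.

Definition precomp (f : cfun R X) : cfun R Y := mkcts (precomp_continuous f).

Lemma precomp_linear : linear precomp.
Proof. by move=> a f g; apply: cfunP. Qed.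

HB.instance Definition _ :=
  GRing.isLinear.Build R[i] (cfun R X) (cfun R Y) _ precomp precomp_linear.

Lemma precomp_star_hom : star_hom precomp.
Proof. by split=> [f g|f]; apply: cfunP. Qed.

End precomposition.

Section real_restriction.
Context {R : realType} {X Y : topologicalType}.
Variable phi : {linear cfun R X -> cfun R Y}.
Hypotheses (phi_unital : unital_map phi) (phi_positive : positive_map phi).
Local Open Scope complex_scope.

(** The map induced by phi on real functions, extended by 0 to discontinuous ones
    so that it is total. *)
Definition real_restriction (f : X -> R) (y : Y) : R :=
  if pselect (continuous f) is left cf then complex.Re (phi (real_cfun f cf) y)
  else 0.

Lemma real_restrictionE (f : X -> R) (cf : continuous f) y :
  real_restriction f y = complex.Re (phi (real_cfun f cf) y).
Proof.
rewrite /real_restriction; case: pselect => // cf'.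
by congr (complex.Re (phi _ y)); apply: cfunP.
Qed.

(** Positivity speaks of nonnegative functions only, so f is written as the
    difference of its positive and negative parts. *)
Lemma positive_map_real (f : X -> R) (cf : continuous f) y :
  phi (real_cfun f cf) y = (real_restriction f y)%:C.
Proof.
pose fp (x : X) : R := Num.max 0 (f x).
pose fm (x : X) : R := Num.max 0 (- f x).
have cp : continuous fp.
  move=> x; apply: (@continuous_max R X (fun=> 0)); first exact: cvg_cst.
  exact: cf.
have cm : continuous fm.
  move=> x; apply: (@continuous_max R X (fun=> 0)); first exact: cvg_cst.
  by apply: cvgN; exact: cf.
have fE : real_cfun f cf = real_cfun fp cp - real_cfun fm cm.
  apply: cfunP => x; rewrite -[RHS]/((fp x)%:C - (fm x)%:C).
  rewrite -rmorphB -[LHS]/((f x)%:C); congr (_%:C).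
  by rewrite /fp /fm; case: (leP 0 (f x)) => ?; case: (leP 0 (- f x)) => ?; lra.
have pos (g : X -> R) (cg : continuous g) : (forall x, 0 <= g x) ->
    complex.Im (phi (real_cfun g cg) y) = 0.
  move=> g0; have : 0 <= phi (real_cfun g cg) y.
    by apply: phi_positive => x; rewrite /= lecR.
  by rewrite lecE => /andP[/eqP].
have Im0 : complex.Im (phi (real_cfun f cf) y) = 0.
  rewrite fE raddfB /=.
  have -> : (phi (real_cfun fp cp) - phi (real_cfun fm cm)) y
    = phi (real_cfun fp cp) y - phi (real_cfun fm cm) y by [].
  by rewrite raddfB /= !pos ?subrr// => x; rewrite le_max lexx.
rewrite (real_restrictionE f cf); move: Im0.
by case: (phi _ y) => a b /= ->.
Qed.

Lemma real_restriction_continuous (f : X -> R) : continuous f ->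
  continuous (real_restriction f).
Proof.
move=> cf; have -> : real_restriction f
    = (fun y => complex.Re (phi (real_cfun f cf) y)).
  by apply/funext => y; exact: real_restrictionE.
exact: Re_continuous.
Qed.

Lemma real_restriction_state y : state (real_restriction ^~ y).
Proof.
split=> [a f g cf cg|f cf f0|].
- have cfg := continuousZD a f g cf cg.
  rewrite (real_restrictionE _ cfg) (real_restrictionE _ cf) (real_restrictionE _ cg).
  have -> : real_cfun _ cfg = a%:C *: real_cfun f cf + real_cfun g cg.
    apply: cfunP => x; rewrite -[LHS]/((a * f x + g x)%:C).
    by rewrite rmorphD rmorphM.
  rewrite linearP /=.
  have -> : (a%:C *: phi (real_cfun f cf) + phi (real_cfun g cg)) y
     = a%:C * phi (real_cfun f cf) y + phi (real_cfun g cg) y by [].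
  by case: (phi _ y) (phi _ y) => [u v] [u' v'] /=; rewrite mul0r subr0.
- rewrite -lecR -(positive_map_real f cf) phi_positive// => x.
  by rewrite /= lecR.
- have c1 : continuous (fun _ : X => 1 : R) by move=> x; exact: cvg_cst.
  rewrite (real_restrictionE _ c1).
  have -> : real_cfun _ c1 = 1 by apply: cfunP.
  by rewrite phi_unital.
Qed.

Lemma phi_complexE (f : cfun R X) y :
  phi f y = real_restriction (fun x => complex.Re (f x)) y
            +i* real_restriction (fun x => complex.Im (f x)) y.
Proof.
rewrite {1}[f]cfun_decomp linearD linearZ /=.
rewrite -[LHS]/(phi (real_cfun _ (Re_continuous f)) y
    + 'i * phi (real_cfun _ (Im_continuous f)) y).
by rewrite !positive_map_real; simpc.
Qed.

End real_restriction.

Theorem theorem1p4 (R : realType) (X Y : topologicalType)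
    (X_compact : compact [set: X]) (X_metrizable : metrizable R X)
    (X_path_connected : path_connected R X)
    (Y_compact : compact [set: Y]) (Y_metrizable : metrizable R Y)
    (p q : X) (z w : Y) (alpha beta : rat)
    (alpha01 : 0 < alpha < 1) (beta01 : 0 < beta < 1)
    (alpha_lt_beta : alpha < beta)
    (F : set (cfun R X)) (F_finite : finite_set F)
    (F_sub : F `<=` cfun_rel p q (ratr alpha))
    (eps : R) (eps_gt0 : 0 < eps)
    (phi : {linear cfun R X -> cfun R Y})
    (phi_unital : unital_map phi) (phi_positive : positive_map phi)
    (phi_rel : forall f, cfun_rel p q (ratr alpha) f ->
                         cfun_rel z w (ratr beta) (phi f)) :
  exists (N : nat) (phi_ : 'I_N -> {linear cfun R X -> cfun R Y}),
    [/\ (0 < N)%N,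
        forall i, star_hom (phi_ i),
        forall f, cfun_rel p q (ratr alpha) f ->
          cfun_rel z w (ratr beta)
            ((N%:R : R[i])^-1 *: \sum_(i < N) phi_ i f)
      & forall f, F f ->
          sup_norm (phi f - (N%:R : R[i])^-1 *: \sum_(i < N) phi_ i f) < eps].
Proof.
move/finite_seqP : F_finite => [s Fs].
pose part (k : 'I_(size s) * bool) (x : X) : R :=
  if k.2 then complex.Re (nth 0 s k.1 x) else complex.Im (nth 0 s k.1 x).
have part_cont k : continuous (part k).
  by case: k => k []; [exact: Re_continuous|exact: Im_continuous].
have e0 : 0 < eps / 4 by rewrite divr_gt0.
have psi_rel (f : X -> R) : continuous f -> f p = ratr alpha * f q ->
    real_restriction phi f z = ratr beta * real_restriction phi f w.
  move=> cf fpq; have : cfun_rel p q (ratr alpha) (real_cfun f cf).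
    by rewrite /cfun_rel /= -[LHS]/((f p)%:C%C) fpq rmorphM.
  move=> /phi_rel; rewrite /cfun_rel /= !positive_map_real// -rmorphM.
  exact: complexI.
have [N [h [N0 ch h_rel h_near]]] := real_average R X Y X_compact X_metrizable
  X_path_connected Y_metrizable p q z w alpha beta (proj2 (andP alpha01)) beta01
  _ part part_cont (eps / 4) e0 (real_restriction phi)
  (real_restriction_continuous phi)
  (real_restriction_state phi phi_unital phi_positive) psi_rel.
exists N, (fun j => precomp (h j) (ch j) : {linear cfun R X -> cfun R Y}).
have NE : (N%:R : R[i])^-1 = (N%:R^-1)%:C%C.
  by rewrite fmorphV /= rmorph_nat.
have avgE f y :
    ((N%:R : R[i])^-1 *: \sum_(j < N) precomp (h j) (ch j) f : cfun R Y) y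
    = ((N%:R^-1 * \sum_(j < N) complex.Re (f (h j y)))
       +i* (N%:R^-1 * \sum_(j < N) complex.Im (f (h j y))))%C.
  rewrite -[LHS]/((N%:R : R[i])^-1 *
    (\sum_(j < N) precomp (h j) (ch j) f : cfun R Y) y).
  rewrite cfun_sumE NE -Re_sum -Im_sum /=.
  by case: (\sum_(j < N) _) => a b /=; simpc.
split=> // [j|f|f Ff].
- exact: precomp_star_hom.
- rewrite /cfun_rel /= => fpq; rewrite !avgE.
  have [Rpq Ipq] : complex.Re (f p) = ratr alpha * complex.Re (f q) /\
                   complex.Im (f p) = ratr alpha * complex.Im (f q).
    by rewrite fpq; case: (f q) => a b /=; rewrite !mul0r subr0 addr0.
  have /= SR := h_rel (fun x => complex.Re (f x)) Rpq.
  have /= SI := h_rel (fun x => complex.Im (f x)) Ipq.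
  rewrite SR SI; simpc.
  by rewrite !(mulrCA N%:R^-1).
- have fs : f \in s by move: Ff; rewrite Fs.
  have ks : (index f s < size s)%N by rewrite index_mem.
  apply: (@le_lt_trans _ _ (eps / 2)); last by lra.
  rewrite /sup_norm; apply: sup_le_ub; first by eexists; exists z.
  move=> _ [y _ <-].
  have -> : eps / 2 = 2 * (eps / 4) by lra.
  rewrite -[X in complex.Re `|X|]/(phi f y -
    ((N%:R : R[i])^-1 *: \sum_(j < N) precomp (h j) (ch j) f : cfun R Y) y).
  have nR := h_near (Ordinal ks, true) y; have nI := h_near (Ordinal ks, false) y.
  rewrite /part /= nth_index// in nR nI.
  rewrite avgE phi_complexE//.
  exact: norm_le_Re_Im.
Qed.
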